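(* Suppose that $\mathcal{P}$ is a hereditary graph property such that for any graph $G\in\mathcal{P}$ and any vertex $v\in V(G)$ there exists a graph $G'\in\mathcal{P}$ which is obtained from $G$ by replacing $v$ by two twin vertices $v_1,v_2$ (which may be either adjacent or non-adjacent to each other) with the same neighbourhoods as $v$ in $G\setminus\{v\}$. Suppose also that there exists a graph $G\in\mathcal{P}$ that is neither a disjoint union of cliques nor a complete multipartite graph. Then $\mathcal{P}$ is uniform.
   Context: Graphs are simple and undirected. A graph property $\mathcal{P}$ is a collection of finite labelled graphs closed under isomorphism; it is hereditary if every induced subgraph of a graph in $\mathcal{P}$ is in $\mathcal{P}$. A random ordering of a finite graph $G$ is a probability distribution on the set of all total orderings of $V(G)$. A consistent random ordering model on a hereditary property $\mathcal{P}$ assigns to each $G\in\mathcal{P}$ a random ordering $\mathbb{P}_G$ of $V(G)$ such that whenever $H,G\in\mathcal{P}$ and $\phi$ is an isomorphism from $H$ onto an induced subgraph of $G$, then for all $x_1,\dots,x_k\in V(H)$, $\mathbb{P}_H(x_1<x_2<\dots<x_k)=\mathbb{P}_G(\phi(x_1)<\phi(x_2)<\dots<\phi(x_k))$. The uniform model takes $\mathbb{P}_G$ to be the uniform distribution on all $|V(G)|!$ orderings for each $G\in\mathcal{P}$; it is consistent. The property $\mathcal{P}$ is called uniform if the uniform model is the only consistent random ordering model on $\mathcal{P}$. Vertices $v_1,v_2$ of a graph $G$ are twins if they have the same neighbourhoods in $G\setminus\{v_1,v_2\}$; twins may be adjacent or non-adjacent. *)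

(* Defs.v *)
From HB Require Import structures.
From mathcomp Require Import all_boot all_order all_algebra.
From mathcomp Require Import reals.

Set Implicit Arguments.
Unset Strict Implicit.
Unset Printing Implicit Defensive.

Import Order.TTheory GRing.Theory Num.Theory.
Local Open Scope ring_scope.

Record sgraph := SGraph {
  vertex :> finType;
  edge : rel vertex;
  edge_sym : symmetric edge;
  edge_irrefl : irreflexive edge
}.

Definition induced_edge (G : sgraph) (S : {set G}) : rel {x : G | x \in S} :=
  fun x y => edge (val x) (val y).

Lemma induced_edge_sym (G : sgraph) (S : {set G}) :
  symmetric (@induced_edge G S).
Proof. by move=> x y; apply: edge_sym. Qed.

Lemma induced_edge_irrefl (G : sgraph) (S : {set G}) :
  irreflexive (@induced_edge G S).
Proof. by move=> x; apply: edge_irrefl. Qed.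

Definition induced (G : sgraph) (S : {set G}) : sgraph :=
  SGraph (@induced_edge_sym G S) (@induced_edge_irrefl G S).

(* phi is an isomorphism from H onto the subgraph of G induced by the image
   of phi; bijectivity is only required onto that image. *)
Definition induced_embedding (H G : sgraph) (phi : H -> G) : Prop :=
  injective phi /\ (forall x y : H, edge (phi x) (phi y) = edge x y).

Definition isomorphic (H G : sgraph) : Prop :=
  exists2 phi : H -> G,
    bijective phi & forall x y : H, edge (phi x) (phi y) = edge x y.

Definition graph_property (P : sgraph -> Prop) : Prop :=
  forall H G : sgraph, isomorphic H G -> P H -> P G.

Definition hereditary (P : sgraph -> Prop) : Prop :=
  forall (G : sgraph) (S : {set G}), P G -> P (induced S).

Definition twins (G : sgraph) (v1 v2 : G) : Prop :=
  v1 != v2 /\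
  (forall u : G, u != v1 -> u != v2 -> edge u v1 = edge u v2).

(* The vertices are those of G \ {v} (left summand) together with the two
   twins [inr true] and [inr false] that replace v; [adj] tells whether the
   twins are adjacent to each other. *)
Definition twin_edge (G : sgraph) (v : G) (adj : bool) :
    rel ({x : G | x \in [set~ v]} + bool)%type :=
  fun a b => match a, b with
  | inl x, inl y => edge (val x) (val y)
  | inl x, inr _ => edge (val x) v
  | inr _, inl y => edge v (val y)
  | inr i, inr j => adj && (i != j)
  end.

Lemma twin_edge_sym (G : sgraph) (v : G) (adj : bool) :
  symmetric (@twin_edge G v adj).
Proof.
by move=> [x|i] [y|j] /=; rewrite ?(eq_sym i); try exact: edge_sym.
Qed.

Lemma twin_edge_irrefl (G : sgraph) (v : G) (adj : bool) :
  irreflexive (@twin_edge G v adj).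
Proof. by move=> [x|i] /=; rewrite ?edge_irrefl ?eqxx ?andbF. Qed.

Definition replace_by_twins (G : sgraph) (v : G) (adj : bool) : sgraph :=
  SGraph (@twin_edge_sym G v adj) (@twin_edge_irrefl G v adj).

Lemma replace_by_twinsP (G : sgraph) (v : G) (adj : bool) :
  @twins (replace_by_twins v adj) (inr true) (inr false).
Proof. by split=> // -[x|[]]. Qed.

(* Cliques and parts are the blocks of a partition D of the vertex set. *)
Definition disjoint_union_of_cliques (G : sgraph) : Prop :=
  exists2 D : {set {set G}}, partition D [set: G] &
    forall x y : G, edge x y = (x != y) && (pblock D x == pblock D y).

Definition complete_multipartite (G : sgraph) : Prop :=
  exists2 D : {set {set G}}, partition D [set: G] &
    forall x y : G, edge x y = (pblock D x != pblock D y).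

(* A total ordering of V is encoded by its strict part {(x, y) | x < y}. *)
Definition strict_total_order (V : finType) (r : {set V * V}) : bool :=
  [&& [forall x, (x, x) \notin r],
      [forall x, forall y, forall z,
         ((x, y) \in r) && ((y, z) \in r) ==> ((x, z) \in r)] &
      [forall x, forall y, (x != y) ==> ((x, y) \in r) || ((y, x) \in r)]].

Record ordering (V : finType) := Ordering {
  ordering_set : {set V * V};
  ordering_setP : strict_total_order ordering_set
}.

HB.instance Definition _ (V : finType) := [isSub for @ordering_set V].
HB.instance Definition _ (V : finType) := [Countable of ordering V by <:].
HB.instance Definition _ (V : finType) := [Finite of ordering V by <:].

Definition precedes (V : finType) (o : ordering V) : rel V :=
  fun x y => (x, y) \in ordering_set o.

Section OrderingCount.
Variable V : finType.

Lemma precedes_irrefl (o : ordering V) : irreflexive (precedes o).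
Proof.
by move=> x; have /and3P[/forallP h _ _] := ordering_setP o; apply/negbTE/h.
Qed.

Lemma precedes_trans (o : ordering V) : transitive (precedes o).
Proof.
have /and3P[_ /forallP h _] := ordering_setP o.
move=> y x z; rewrite /precedes => xy yz.
by have /forallP/(_ y)/forallP/(_ z) := h x; rewrite xy yz.
Qed.

Lemma precedes_total (o : ordering V) (x y : V) :
  x != y -> precedes o x y || precedes o y x.
Proof.
by have /and3P[_ _ /forallP/(_ x)/forallP/(_ y)/implyP] := ordering_setP o.
Qed.

Definition rank_set (f : {ffun V -> 'I_#|V|}) : {set V * V} :=
  [set p | (f p.1 < f p.2)%N].

Lemma rank_setP (f : {ffun V -> 'I_#|V|}) :
  injective f -> strict_total_order (rank_set f).
Proof.
move=> fI; apply/and3P; split.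
- by apply/forallP => x; rewrite inE ltnn.
- apply/forallP => x; apply/forallP => y; apply/forallP => z.
  by apply/implyP; rewrite !inE /= => /andP[]; apply: ltn_trans.
- apply/forallP => x; apply/forallP => y; apply/implyP => xy.
  by rewrite !inE /= -neq_ltn; apply: contra xy => /eqP/val_inj/fI ->.
Qed.

Lemma rank_subproof (o : ordering V) (x : V) :
  (#|[set y | precedes o y x]| < #|V|)%N.
Proof.
rewrite -cardsT; apply: proper_card; apply/properP; split.
  exact: subsetT.
by exists x; rewrite ?inE // precedes_irrefl.
Qed.

Definition rank (o : ordering V) : {ffun V -> 'I_#|V|} :=
  [ffun x => Ordinal (rank_subproof o x)].

Lemma rank_lt (o : ordering V) (x y : V) :
  (rank o x < rank o y)%N = precedes o x y.
Proof.
have lt u v : precedes o u v -> (rank o u < rank o v)%N.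
  move=> uv; rewrite !ffunE /=; apply: proper_card; apply/properP; split.
    by apply/subsetP => w; rewrite !inE => wu; apply: precedes_trans uv.
  by exists u; rewrite !inE ?precedes_irrefl.
apply/idP/idP; last exact: lt.
have [->|xy] := eqVneq x y; first by rewrite ltnn.
by case/orP: (precedes_total o xy) => // /lt /ltnW; rewrite leqNgt => /negbTE ->.
Qed.

Lemma rank_inj (o : ordering V) : injective (rank o).
Proof.
move=> x y exy; apply/eqP/negPn/negP => /(precedes_total o).
by rewrite -!rank_lt exy ltnn.
Qed.

Lemma card_ordering : #|{: ordering V}| = (#|V|)`!.
Proof.
pose A := [set f : {ffun V -> 'I_#|V|} | injectiveb f].
have <- : #|A| = (#|V|)`! by rewrite card_inj_ffuns card_ord ffactnn.
have rank_injo : injective rank.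
  move=> o1 o2 e; apply: val_inj; apply/setP => -[x y] /=.
  by have := rank_lt o1 x y; rewrite e rank_lt.
rewrite -(card_imset _ rank_injo); congr #|pred_of_set _|.
apply/setP => f; rewrite inE; apply/imsetP/injectiveP => [[o _ ->]|fI].
  exact: rank_inj.
exists (Ordering (rank_setP fI)) => //; apply/ffunP => x.
have [g fK gK] : bijective f by apply: inj_card_bij; rewrite ?card_ord.
apply: val_inj; rewrite ffunE /=.
have -> : [set y | precedes (Ordering (rank_setP fI)) y x]
        = g @: [set i : 'I_#|V| | (i < f x)%N].
  apply/setP => y; rewrite inE /precedes inE /=.
  apply/idP/imsetP => [h|[i]]; first by exists (f y); rewrite ?inE ?fK.
  by rewrite inE => h ->; rewrite gK.
rewrite card_imset; last exact: can_inj gK.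
by rewrite -sum1dep_card big_ord_narrow ?sum1_card ?card_ord // ltnW.
Qed.

End OrderingCount.

Record random_ordering (R : realType) (V : finType) := RandomOrdering {
  pmf :> ordering V -> R;
  pmf_ge0 : forall o : ordering V, 0 <= pmf o;
  pmf_sum1 : \sum_(o : ordering V) pmf o = 1
}.

(* The probability that x_1 < x_2 < ... < x_k, for xs = [:: x_1; ...; x_k]. *)
Definition prob_chain (R : realType) (V : finType) (mu : random_ordering R V)
    (xs : seq V) : R :=
  \sum_(o : ordering V | sorted (precedes o) xs) mu o.

Definition ordering_model (R : realType) (P : sgraph -> Prop) : Type :=
  forall G : sgraph, P G -> random_ordering R G.

Definition consistent (R : realType) (P : sgraph -> Prop)
    (M : ordering_model R P) : Prop :=
  forall (H G : sgraph) (PH : P H) (PG : P G) (phi : H -> G),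
    induced_embedding phi ->
    forall xs : seq H,
      prob_chain (M H PH) xs = prob_chain (M G PG) (map phi xs).

Lemma uniform_ge0 (R : realType) (V : finType) (o : ordering V) :
  0 <= ((#|V|)`!)%:R^-1 :> R.
Proof. by rewrite invr_ge0 ler0n. Qed.

Lemma uniform_sum1 (R : realType) (V : finType) :
  \sum_(o : ordering V) ((#|V|)`!)%:R^-1 = 1 :> R.
Proof.
rewrite sumr_const card_ordering -[LHS]mulr_natl mulfV //.
by rewrite pnatr_eq0 -lt0n fact_gt0.
Qed.

Definition uniform_ordering (R : realType) (V : finType) :
    random_ordering R V :=
  RandomOrdering (@uniform_ge0 R V) (@uniform_sum1 R V).

Definition uniform_model (R : realType) (P : sgraph -> Prop) :
    ordering_model R P :=
  fun G _ => uniform_ordering R G.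

Definition uniform_property (R : realType) (P : sgraph -> Prop) : Prop :=
  consistent (@uniform_model R P) /\
  (forall M : ordering_model R P, consistent M ->
     forall (G : sgraph) (PG : P G), M G PG =1 uniform_model R PG).

(* Main.v *)
Require Import Defs.
From HB Require Import structures.
From mathcomp Require Import all_boot all_order all_algebra.
From mathcomp Require Import reals boolp ring lra.

(** The twin condition lets every vertex of a graph of the property be blown up
    into an arbitrarily large class of clones which is a clique or an
    independent set ([blowup_exists]).  As the classes grow, the clones of [x]
    have, in a random ordering, a random empirical distribution function [F_x],
    and the ordering of one clone per class looks like independent samples from
    these random distributions.  A consistent model is uniform as soon as all
    the [F_x] coincide.

    The expectations of [F_x F_y], sampled at a clone of a third vertex, only
    involve the ordering of three vertices.  Complete and empty triples are
    uniform by symmetry, so everything depends on two numbers: the excess over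
    1/3 of the probability that the centre of a cherry (an induced path on three
    vertices) comes last, called [s], and the excess [t] for the isolated vertex
    of a cocherry (an edge and an isolated vertex).

    These numbers vanish.  The expectation of the square of a linear combination
    of the [F_x] is nonnegative ([blowup_excess_psd]), and well chosen
    combinations show that [0 <= s], and that if [0 < s], then the ends of every
    cherry have independent clones while the ends of the edge of every cocherry
    have adjacent clones.  A graph which is neither a disjoint union of cliques
    nor complete multipartite contains a cherry and a cocherry, and no choice of
    clone types then meets both requirements ([cherry_excess_eq0]).  The
    argument is invariant under complementation, which exchanges [s] and [t].

    Hence all triples are uniform, and then the squared difference of [F_x] and
    [F_y] has expectation tending to zero: replacing a vertex of a chain by a
    vertex of any other class does not change the probability of the chain
    ([prob_chain_replace]).  Two enumerations of the vertices of a graph, placed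
    in two disjoint layers of a blow-up, are linked by such replacements, so all
    orderings of the graph have the same probability. *)

Set Implicit Arguments.
Unset Strict Implicit.
Unset Printing Implicit Defensive.

Import Order.TTheory GRing.Theory Num.Theory.

(** * Blow-ups with homogeneous classes of clones *)

Section Blowups.

Variable P : sgraph -> Prop.
Hypothesis P_iso : graph_property P.
Hypothesis P_hereditary : hereditary P.

Lemma property_embedding (H G : sgraph) (phi : H -> G) :
  induced_embedding phi -> P G -> P H.
Proof.
move=> [phiI phiE] PG; pose S := phi @: [set: H].
have phiS x : phi x \in S by apply: imset_f.
pose psi x : induced S := exist _ (phi x) (phiS x).
have psiI : injective psi by move=> x y [/phiI].
have [] := inj_card_bij psiI.
  by rewrite card_sig card_imset // cardsT.
move=> g psiK gK; apply: P_iso (P_hereditary S PG); exists g.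
  by exists psi.
by move=> x y; rewrite -[x in RHS]gK -[y in RHS]gK -phiE.
Qed.

Hypothesis P_twins : forall G : sgraph, P G -> forall v : G,
  exists adj : bool, P (replace_by_twins v adj).

Definition add_clone_edge (G : sgraph) (v : G) (adj : bool) : rel (option G) :=
  fun a b => match a, b with
  | Some x, Some y => edge x y
  | Some x, None | None, Some x => if x == v then adj else edge x v
  | None, None => false
  end.

Lemma add_clone_sym (G : sgraph) (v : G) (adj : bool) :
  symmetric (add_clone_edge v adj).
Proof. by move=> [x|] [y|] //=; apply: edge_sym. Qed.

Lemma add_clone_irrefl (G : sgraph) (v : G) (adj : bool) :
  irreflexive (add_clone_edge v adj).
Proof. by move=> [x|] //=; apply: edge_irrefl. Qed.

Definition add_clone (G : sgraph) (v : G) (adj : bool) : sgraph :=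
  SGraph (add_clone_sym v adj) (add_clone_irrefl v adj).

Lemma property_add_clone (G : sgraph) (v : G) :
  P G -> exists adj, P (add_clone v adj).
Proof.
move=> /P_twins/(_ v)[adj PG]; exists adj.
pose f (a : option G) : ({x : G | x \in [set~ v]} + bool)%type :=
  if a is Some x then (if insub x is Some u then inl u else inr true)
  else inr false.
have fE x : (x = v /\ f (Some x) = inr true) \/
    (exists u, [/\ (x == v) = false, x = val u & f (Some x) = inl u]).
  rewrite /f; case: insubP => [u|]; rewrite !inE ?negbK => xv.
    by move=> ux; right; exists u; rewrite ux (negPf xv).
  by left; rewrite (eqP xv).
apply: (@property_embedding (add_clone v adj) (replace_by_twins v adj) f) PG.
split=> [] [x|] [y|] //.
- case: (fE x) => [[-> ->]|[u [_ -> ->]]]; case: (fE y) => [[-> ->]|[w [_ -> ->]]] //.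
  by case=> ->.
- by case: (fE x) => [[-> ->]|[u [_ -> ->]]].
- by case: (fE y) => [[-> ->]|[u [_ -> ->]]].
- case: (fE x) => [[-> ->]|[u [_ -> ->]]];
    case: (fE y) => [[-> ->]|[w [_ -> ->]]] //=.
  by rewrite edge_irrefl andbF.
- by case: (fE x) => [[-> ->]|[u [xv xu ->]]] /=; rewrite ?eqxx ?andbT // xv xu.
- case: (fE y) => [[-> ->]|[u [yv yu ->]]] /=; rewrite ?eqxx ?andbT //.
  by rewrite yv edge_sym yu.
- by rewrite /= andbF.
Qed.

(** The clones [w 0], [w 1], ... are split off one after the other from the same
    vertex [v].  Every later clone is then split off from [v] after [w i], so it
    inherits the adjacency [a i] between [w i] and [v]: the adjacency of two
    clones depends only on the older one, so that homogeneous classes can be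
    found by the pigeonhole principle. *)
Lemma clone_sequence (G : sgraph) (v : G) (n : nat) : P G ->
  exists (H : sgraph) (a : nat -> bool) (phi : G -> H) (w : nat -> H),
    [/\ P H, induced_embedding phi,
        forall i, i < n -> forall x,
          w i != phi x /\
          edge (w i) (phi x) = (if x == v then a i else edge x v)
      & forall i j, i < j < n -> w i != w j /\ edge (w i) (w j) = a i].
Proof.
move=> PG; elim: n => [|n [H [a [phi [w [PH phiE wphi ww]]]]]].
  exists G, xpredT, id, (fun=> v); split=> //; first by split.
  by move=> i j; rewrite andbF.
have [adj PH'] := property_add_clone (phi v) PH.
have [phiI phiEd] := phiE.
exists (add_clone (phi v) adj), (fun i => if i == n then adj else a i),
  (Some \o phi), (fun i => if i == n then None else Some (w i)).
split=> //.
- by split=> [x y [/phiI]|x y] //=.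
- move=> i; rewrite ltnS leq_eqVlt; case: eqVneq => [-> _ x|_ /= ltin x].
    by rewrite /= (inj_eq phiI) phiEd.
  exact: wphi.
- move=> i j; rewrite ltnS andbC leq_eqVlt; case: (eqVneq j n) => [-> /= ltin|_].
    rewrite (ltn_eqF ltin); split=> //=.
    by have [/negPf-> ->] := wphi _ ltin v; rewrite eqxx.
  move=> /= /andP[ltjn ltij]; rewrite (ltn_eqF (ltn_trans ltij ltjn)) /=.
  by apply: ww; rewrite ltij.
Qed.

Definition add_clones_edge (G : sgraph) (v : G) (I : finType) (b : bool) :
    rel (G + I)%type :=
  fun p q => match p, q with
  | inl x, inl y => edge x y
  | inl x, inr _ | inr _, inl x => if x == v then b else edge x v
  | inr i, inr j => (i != j) && b
  end.

Lemma add_clones_sym (G : sgraph) (v : G) (I : finType) (b : bool) :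
  symmetric (@add_clones_edge G v I b).
Proof. by move=> [x|i] [y|j] //=; rewrite 1?eq_sym 1?edge_sym. Qed.

Lemma add_clones_irrefl (G : sgraph) (v : G) (I : finType) (b : bool) :
  irreflexive (@add_clones_edge G v I b).
Proof. by move=> [x|i] /=; rewrite ?edge_irrefl ?eqxx. Qed.

Definition add_clones (G : sgraph) (v : G) (I : finType) (b : bool) : sgraph :=
  SGraph (@add_clones_sym G v I b) (@add_clones_irrefl G v I b).

(** Of [n + n] clones obtained from [v] in sequence, [n] share the same value of
    [a]; together with [v] they form a clique or an independent set. *)
Lemma property_add_clones (G : sgraph) (v : G) (n : nat) :
  P G -> exists b, P (@add_clones G v 'I_n b).
Proof.
move=> /(clone_sequence v (n + n)) [H [a [phi [w [PH [phiI phiE] wphi ww]]]]].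
have [b bn] : exists b, n <= size [seq i <- iota 0 (n + n) | a i == b].
  have := size_iota 0 (n + n).
  rewrite -(count_predC (fun i => a i == true)) -!size_filter.
  case: (leqP n (size [seq i <- iota 0 (n + n) | a i == true])) => [|lt e].
    by exists true.
  exists false; rewrite -(eq_filter (a1 := predC (fun i => a i == true))).
    rewrite leqNgt; apply/negP => lt'.
    by have := leq_add lt (ltnW lt'); rewrite addSn e ltnn.
  by move=> i /=; case: (a i).
exists b; set s := filter _ _ in bn.
have s_sorted : sorted ltn s.
  by apply: (sorted_filter ltn_trans); apply: iota_ltn_sorted.
have s_lt (i : 'I_n) : nth 0 s i < n + n /\ a (nth 0 s i) = b.
  have : nth 0 s i \in s by rewrite mem_nth // (leq_trans _ bn).
  by rewrite mem_filter mem_iota => /andP[/eqP ? /andP[]].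
have s_mono (i j : 'I_n) : i < j -> nth 0 s i < nth 0 s j.
  by apply: (sorted_ltn_nth ltn_trans); rewrite ?inE ?(leq_trans _ bn).
have ws (i j : 'I_n) : i != j ->
    w (nth 0 s i) != w (nth 0 s j) /\ edge (w (nth 0 s i)) (w (nth 0 s j)) = b.
  wlog ltij : i j / i < j => [thW|_].
    by rewrite neq_ltn => /orP[] /[dup] lt /thW; rewrite neq_ltn lt ?orbT;
      [|rewrite eq_sym edge_sym]; apply.
  have lt : nth 0 s i < nth 0 s j < n + n by rewrite s_mono // (s_lt j).1.
  by have [-> ->] := ww _ _ lt; rewrite (s_lt i).2.
apply: (@property_embedding (add_clones v 'I_n b) _
  (fun p => match p with inl x => phi x | inr i => w (nth 0 s i) end)) PH.
split.
  move=> [x|i] [y|j].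
  - by move/phiI->.
  - by move=> e; have [/eqP] := wphi _ (s_lt j).1 x; rewrite e.
  - by move=> e; have [/eqP] := wphi _ (s_lt i).1 y.
  - by have [->|/ws[/eqP]] := eqVneq i j.
move=> [x|i] [y|j] /=.
- exact: phiE.
- by rewrite edge_sym (wphi _ (s_lt j).1 x).2 (s_lt j).2.
- by rewrite (wphi _ (s_lt i).1 y).2 (s_lt i).2.
- by have [->|/ws[_ ->]] := eqVneq i j; rewrite ?edge_irrefl.
Qed.

End Blowups.

(** The adjacency of two distinct vertices lying in the classes of [x] and [y].
    It is a symmetric relation with loops, the loop at [x] telling whether the
    clones of [x] are adjacent. *)
Definition clone_adjacency (G : sgraph) (tau : {ffun G -> bool}) : rel G :=
  fun x y => if x == y then tau x else edge x y.

Lemma clone_adjacency_sym (G : sgraph) (tau : {ffun G -> bool}) :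
  symmetric (clone_adjacency tau).
Proof.
by move=> x y; rewrite /clone_adjacency eq_sym edge_sym; case: eqP => [->|].
Qed.

Definition blowup_edge (G : sgraph) (I : finType) (tau : {ffun G -> bool}) :
    rel (G * I)%type :=
  fun p q => (p != q) && clone_adjacency tau p.1 q.1.

Lemma blowup_sym (G : sgraph) (I : finType) (tau : {ffun G -> bool}) :
  symmetric (@blowup_edge G I tau).
Proof. by move=> p q; rewrite /blowup_edge eq_sym clone_adjacency_sym. Qed.

Lemma blowup_irrefl (G : sgraph) (I : finType) (tau : {ffun G -> bool}) :
  irreflexive (@blowup_edge G I tau).
Proof. by move=> p; rewrite /blowup_edge eqxx. Qed.

Definition blowup (G : sgraph) (I : finType) (tau : {ffun G -> bool}) : sgraph :=
  SGraph (@blowup_sym G I tau) (@blowup_irrefl G I tau).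

Section BlowupExistence.

Variable P : sgraph -> Prop.
Hypothesis P_iso : graph_property P.
Hypothesis P_hereditary : hereditary P.
Hypothesis P_twins : forall G : sgraph, P G -> forall v : G,
  exists adj : bool, P (replace_by_twins v adj).

(** The vertices of [s] have already been blown up; [None] indexes the original
    copy of a vertex and [Some l] its clones. *)
Lemma partial_blowup (G : sgraph) (n : nat) (s : seq G) : P G ->
  exists (H : sgraph) (tau : {ffun G -> bool}) (g : G * option 'I_n -> H),
    P H /\
    let D := [pred p : G * option 'I_n | (p.2 == None) || (p.1 \in s)] in
    {in D &, forall p q, p != q ->
       g p != g q /\ edge (g p) (g q) = clone_adjacency tau p.1 q.1}.
Proof.
move=> PG; elim: s => [|x s [H [tau [g [PH /= gE]]]]].
  exists G, [ffun=> true], fst; split=> //= -[x o] [y o'] /=.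
  rewrite !inE !orbF /= => /eqP-> /eqP->.
  by rewrite /clone_adjacency xpair_eqE eqxx andbT => xy; rewrite (negPf xy).
have [xs|xs] := boolP (x \in s).
  have sub y : (y == x) || (y \in s) = (y \in s) by case: eqP => [->|].
  by exists H, tau, g; split=> // p q; rewrite !inE !sub; apply: gE.
have [b PH'] := property_add_clones P_iso P_hereditary P_twins (g (x, None)) n PH.
pose H' := @add_clones H (g (x, None)) 'I_n b.
pose tau' : {ffun G -> bool} := [ffun y => if y == x then b else tau y].
pose g' (p : G * option 'I_n) : H' := match p with
  | (y, Some l) => if y == x then inr l else inl (g p)
  | _ => inl (g p) end.
exists H', tau', g'; split=> //; set D := [pred p | _].
pose D0 := [pred p : G * option 'I_n | (p.2 == None) || (p.1 \in s)].
have DE p : p \in D -> p \in D0 \/ exists l, p = (x, Some l).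
  case: p => y [l|]; rewrite !inE /=; last by left.
  by case/orP => [/eqP->|]; [right; exists l | left].
have g'0 p : p \in D0 -> g' p = inl (g p).
  case: p => y [l|]; rewrite !inE //= => ys.
  by case: eqP => // yx; rewrite -yx ys in xs.
have adjE p q : p \in D0 -> q \in D0 -> p != q ->
    clone_adjacency tau' p.1 q.1 = clone_adjacency tau p.1 q.1.
  case: p q => [y o] [z o']; rewrite !inE /= => Dp Dq.
  rewrite xpair_eqE /clone_adjacency ffunE.
  case: (eqVneq y z) => //= yz; case: (eqVneq y x) => // yx.
  move: Dp Dq; rewrite -yz yx.
  by rewrite (negPf xs) !orbF => /eqP-> /eqP->.
have one l q : q \in D0 ->
    g' q != g' (x, Some l) /\
    edge (g' q) (g' (x, Some l)) = clone_adjacency tau' q.1 x.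
  move=> Dq; rewrite g'0 //= eqxx; split=> //.
  have D0x : (x, None) \in D0 by rewrite !inE.
  case: (eqVneq q (x, None)) => [->|qx].
    by rewrite eqxx /clone_adjacency eqxx ffunE eqxx.
  have [/negPf-> ->] := gE _ _ Dq D0x qx.
  by rewrite (adjE q (x, None)).
move=> p q /DE[Dp|[l ->]] /DE[Dq|[k ->]] pq.
- by rewrite !g'0 // adjE //; have [gpq <-] := gE p q Dp Dq pq.
- exact: one.
- by rewrite eq_sym edge_sym clone_adjacency_sym; apply: one.
- rewrite /= eqxx /clone_adjacency eqxx ffunE eqxx.
  have lk : l != k by apply: contraNneq pq => ->.
  by split=> /=; rewrite ?lk //; exact: lk.
Qed.

Lemma blowup_embedding (G : sgraph) (I J : finType) (tau : {ffun G -> bool})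
    (f : I -> J) : injective f ->
  @induced_embedding (blowup I tau) (blowup J tau) (fun p => (p.1, f p.2)).
Proof.
move=> fI; have gI : injective (fun p : G * I => (p.1, f p.2)).
  by move=> [x i] [y j] /= [-> /fI->].
by split=> // p q; rewrite /= /blowup_edge (inj_eq gI).
Qed.

Lemma blowup_size (G : sgraph) (n : nat) : P G ->
  exists tau : {ffun G -> bool}, P (blowup 'I_n tau).
Proof.
move=> /(partial_blowup n (enum G)) [H [tau [g [PH /= gE]]]]; exists tau.
have {}gE (p q : G * option 'I_n) : p != q ->
    g p != g q /\ edge (g p) (g q) = clone_adjacency tau p.1 q.1.
  by apply: gE; rewrite !inE mem_enum orbT.
apply: (property_embedding P_iso P_hereditary
  (phi := fun p : blowup 'I_n tau => g (p.1, Some p.2))) PH; split.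
  move=> [x i] [y j] /= e; apply/eqP/negPn/negP => pq.
  have [] := gE (x, Some i) (y, Some j); last by rewrite e eqxx.
  by apply: contraNneq pq => -[-> ->].
move=> [x i] [y j] /=; rewrite /blowup_edge.
have [[-> ->]|pq] := eqVneq (x, i) (y, j); first by rewrite edge_irrefl.
have [] // := gE (x, Some i) (y, Some j).
Qed.

(** For each size there are suitable clone types [tau], and there are finitely
    many types; since types are inherited by smaller blow-ups, one [tau] works for
    all sizes. *)
Lemma blowup_exists (G : sgraph) : P G ->
  exists tau : {ffun G -> bool}, forall I : finType, P (blowup I tau).
Proof.
move=> PG; apply: contrapT => no_tau.
have /choice[N NP] (tau : {ffun G -> bool}) :
    exists n, ~ P (blowup 'I_n tau).
  apply: contrapT => tauP; apply: no_tau; exists tau => I.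
  apply: (property_embedding P_iso P_hereditary
    (blowup_embedding tau (@enum_rank_inj I))).
  by apply: contrapT => nP; apply: tauP; exists #|I|.
have [tau Ptau] := blowup_size (\max_tau N tau) PG.
apply: (NP tau); move: Ptau; have le := leq_bigmax tau (F := N).
apply: property_embedding => //.
apply: (blowup_embedding tau (f := widen_ord le)).
by move=> i j e; apply: val_inj; have := congr1 val e.
Qed.

End BlowupExistence.

Local Open Scope ring_scope.

(** * Consequences of positivity of second moments *)

(** The excess over 1/3 of the probability that [c] comes after [u] and [v] in a
    triple of vertices with adjacencies [cu], [cv] (of [c]) and [uv].  When [c] is
    an end of a cherry or of the edge of a cocherry, the value follows from the
    symmetry of the two ends, the three probabilities having sum 1. *)
Definition excess (R : fieldType) (s t : R) (cu cv uv : bool) : R :=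
  if cu == cv then (if cu == uv then 0 else if cu then s else t)
  else if uv then - s / 2 else - t / 2.

Lemma excess_compl (R : fieldType) (s t : R) (cu cv uv : bool) :
  excess t s (~~ cu) (~~ cv) (~~ uv) = excess s t cu cv uv.
Proof. by case: cu; case: cv; case: uv. Qed.

(** When [e] is the adjacency of the classes of a blow-up, the double sum is the
    limit of the expected square of [\sum_p p.2 * F_(p.1)] sampled at a clone of
    [c]; the constant 1/3 disappears because the coefficients have sum zero. *)
Definition excess_psd (R : realFieldType) (V : Type) (e : rel V) (s t : R) :=
  forall (c : V) (L : seq (V * R)), \sum_(p <- L) p.2 = 0 ->
    0 <= \sum_(p <- L) \sum_(q <- L)
           p.2 * q.2 * excess s t (e c p.1) (e c q.1) (e p.1 q.1).

Lemma excess_psd_compl (R : realFieldType) (V : Type) (e : rel V) (s t : R) :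
  excess_psd e s t -> excess_psd (fun x y => ~~ e x y) t s.
Proof.
move=> psd c L L0; have := psd c L L0; congr (0 <= _).
by apply: eq_bigr => p _; apply: eq_bigr => q _; rewrite excess_compl.
Qed.

(** The square of [F_a + F_c - 2 F_b], sampled in the class of the centre [b], has
    expectation [s] times a number which is at least 2, whatever the clone
    types. *)
Lemma cherry_excess_ge0 (R : realFieldType) (V : Type) (e : rel V) (s t : R)
    (a b c : V) :
  symmetric e -> excess_psd e s t ->
  e a b -> e b c -> ~~ e a c -> 0 <= s.
Proof.
move=> e_sym psd ab bc /negPf ac.
have := psd b [:: (a, 1); (c, 1); (b, - 2)].
rewrite !big_cons !big_nil /= (e_sym b a) (e_sym c a) (e_sym c b) ab bc ac.
rewrite /excess.
by case: (e a a); case: (e b b); case: (e c c) => /= /(_ ltac:(lra)); lra.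
Qed.

Section PositiveExcess.

Variables (R : realFieldType) (V : Type) (e : rel V) (s t : R).
Hypotheses (e_sym : symmetric e) (psd : excess_psd e s t) (s_gt0 : 0 < s).

(** If the clones of [a] were adjacent, then the square of [F_a - F_c], sampled in
    the class of [b], would have expectation at most [- s]. *)
Lemma cherry_end (a b c : V) : e a b -> e b c -> ~~ e a c -> ~~ e a a.
Proof.
move=> ab bc /negPf ac; apply/negP => aa.
suff : s <= 0 by rewrite leNgt s_gt0.
have := @psd b [:: (a, 1); (c, - 1)].
rewrite !big_cons !big_nil /= (e_sym b a) (e_sym c a) ab bc ac aa /excess.
by case: (e c c) => /= /(_ ltac:(lra)); lra.
Qed.

(** Suppose that the clones of [a] are independent.  Sampling [F_a - F_b] in the
    class of [c] shows that [t <= 0], so that [t = 0].  Sampling in the class of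
    [a], the function [F_a - F_c] then has a vanishing second moment, but its
    product with [F_b] has a nonzero expectation: adding a small multiple of
    [F_b - F_a] gives a square of negative expectation. *)
Lemma cocherry_end (a b c : V) : e a b -> ~~ e a c -> ~~ e b c -> e a a.
Proof.
move=> ab nac nbc; apply/negPn/negP => /negPf aa.
have t_ge0 : 0 <= t.
  apply: (cherry_excess_ge0 _ (excess_psd_compl psd) nac (b := c) (c := b)).
  - by move=> x y; rewrite e_sym.
  - by rewrite e_sym.
  - by rewrite negbK.
move: nac nbc => /negPf ac /negPf bc.
have t_le0 : t <= 0.
  have := @psd c [:: (a, 1); (b, - 1)].
  rewrite !big_cons !big_nil /= (e_sym c a) (e_sym c b) (e_sym b a) ac bc ab aa.
  rewrite /excess.
  by case: (e b b) => /= /(_ ltac:(lra)); lra.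
suff : s <= 0 by rewrite leNgt s_gt0.
(* [4 (F_a - F_c) + (F_b - F_a)]: the ratio 4 is large enough for the cross term,
   of order [s], to exceed the square of [F_b - F_a]. *)
have := @psd a [:: (b, 1); (c, - 4); (a, 3)].
rewrite !big_cons !big_nil /= (e_sym c a) (e_sym c b) (e_sym b a) ac bc ab aa.
rewrite /excess.
by case: (e b b); case: (e c c) => /= /(_ ltac:(lra)); lra.
Qed.

End PositiveExcess.

(** If [0 < s], the clones of [x] are independent and those of [a] adjacent, so
    that [a] ends no cherry and [x] ends no edge of a cocherry.  If [a] and [x]
    are adjacent, then [a x c] is a cherry or [a x] and [c] form a cocherry; if
    not, then [a y x] is a cherry or [x y] and [a] form a cocherry. *)
Lemma cherry_excess_eq0 (R : realFieldType) (V : Type) (e : rel V) (s t : R)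
    (x y z a b c : V) :
  symmetric e -> excess_psd e s t ->
  e x y -> e y z -> ~~ e x z ->
  e a b -> ~~ e a c -> ~~ e b c -> s = 0.
Proof.
move=> e_sym psd xy yz xz ab ac bc; apply/eqP; rewrite eq_le.
rewrite (cherry_excess_ge0 e_sym psd xy yz xz) andbT leNgt; apply/negP => s_gt0.
have end1 := cherry_end e_sym psd s_gt0.
have end2 := cocherry_end e_sym psd s_gt0.
have nxx := end1 _ _ _ xy yz xz.
have aa := end2 _ _ _ ab ac bc.
have [ax|nax] := boolP (e a x).
  have [xc|nxc] := boolP (e x c); first by have := end1 _ _ _ ax xc ac; rewrite aa.
  by have := end2 x a c; rewrite (e_sym x a) (negPf nxx); case/(_ ax nxc ac)/negP.
have [ay|nay] := boolP (e a y).
  by have := end1 a y x; rewrite (e_sym y x) aa => /(_ ay xy nax).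
have := end2 x y a; rewrite (negPf nxx) (e_sym x a) (e_sym y a).
by move/(_ xy nax nay).
Qed.

(** * Expectations under a random ordering *)

Section Expectation.

Variables (R : realType) (V : finType) (mu : random_ordering R V).

Definition expect (f : ordering V -> R) : R := \sum_o mu o * f o.

Lemma expectD f g : expect (fun o => f o + g o) = expect f + expect g.
Proof. by rewrite /expect -big_split; apply: eq_bigr => o _; rewrite mulrDr. Qed.

Lemma expectZ a f : expect (fun o => a * f o) = a * expect f.
Proof. by rewrite /expect mulr_sumr; apply: eq_bigr => o _; rewrite mulrCA. Qed.

Lemma expect_sum (I : Type) (r : seq I) (F : I -> ordering V -> R) :
  expect (fun o => \sum_(i <- r) F i o) = \sum_(i <- r) expect (F i).
Proof.
by rewrite /expect exchange_big; apply: eq_bigr => o _; rewrite mulr_sumr.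
Qed.

Lemma expect_le f g : (forall o, f o <= g o) -> expect f <= expect g.
Proof. by move=> fg; apply: ler_sum => o _; apply: ler_wpM2l; [exact: pmf_ge0|]. Qed.

Lemma eq_expect f g : f =1 g -> expect f = expect g.
Proof. by move=> fg; apply: eq_bigr => o _; rewrite fg. Qed.

Lemma expect_const a : expect (fun=> a) = a.
Proof. by rewrite /expect -mulr_suml pmf_sum1 mul1r. Qed.

Lemma prob_chain_expect xs :
  prob_chain mu xs = expect (fun o => (sorted (precedes o) xs)%:R).
Proof.
rewrite /prob_chain big_mkcond; apply: eq_bigr => o _.
by case: ifP; rewrite ?mulr1 ?mulr0.
Qed.

Definition prob_last (c u v : V) : R :=
  expect (fun o => (precedes o u c && precedes o v c)%:R).

Lemma precedes_asym (o : ordering V) (x y : V) :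
  x != y -> precedes o y x = ~~ precedes o x y.
Proof.
move=> xy; have := precedes_total o xy.
case xy' : (precedes o x y); case yx : (precedes o y x) => //= _.
by have := precedes_trans xy' yx; rewrite precedes_irrefl.
Qed.

Lemma prob_lastC (c u v : V) : prob_last c u v = prob_last c v u.
Proof. by apply: eq_expect => o; rewrite andbC. Qed.

Lemma prob_lastE (c u v : V) : u != v ->
  prob_last c u v = prob_chain mu [:: u; v; c] + prob_chain mu [:: v; u; c].
Proof.
move=> uv; rewrite !prob_chain_expect -expectD; apply: eq_expect => o /=.
rewrite !andbT (precedes_asym o uv).
case: (boolP (precedes o u v)) => [uv'|uv'] /=; rewrite ?addr0 ?add0r.
  case vc : (precedes o v c); rewrite ?andbF //.
  by rewrite (precedes_trans uv' vc).
have {}uv' : precedes o v u by rewrite precedes_asym.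
case uc : (precedes o u c); rewrite ?andbF //=.
by rewrite (precedes_trans uv' uc).
Qed.

Lemma prob_last_sum (x y z : V) : x != y -> x != z -> y != z ->
  prob_last x y z + prob_last y x z + prob_last z x y = 1.
Proof.
move=> xy xz yz; rewrite -!expectD -[RHS](expect_const 1).
apply: eq_expect => o; rewrite (precedes_asym o xy) (precedes_asym o xz).
rewrite (precedes_asym o yz).
case: (boolP (precedes o x y)); case: (boolP (precedes o x z));
  case: (boolP (precedes o y z)) => /= oyz oxz oxy; try ring.
  by have := precedes_trans oxy oyz; rewrite (negPf oxz).
have ozy : precedes o z y by rewrite precedes_asym.
have oyx : precedes o y x by rewrite precedes_asym.
by have := precedes_trans ozy oyx; rewrite precedes_asym ?oxz.
Qed.

Lemma prob_last_diag (c u : V) : c != u ->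
  prob_last c u u = prob_chain mu [:: u; c].
Proof.
move=> cu; rewrite prob_chain_expect; apply: eq_expect => o /=.
by rewrite andbT andbb.
Qed.

Lemma prob_pair_sum (x y : V) : x != y ->
  prob_chain mu [:: x; y] + prob_chain mu [:: y; x] = 1.
Proof.
move=> xy; rewrite !prob_chain_expect -expectD -[RHS](expect_const 1).
apply: eq_expect => o; rewrite /= !andbT (precedes_asym o xy).
by case: (precedes o x y) => /=; ring.
Qed.

End Expectation.

(** * Chains and triples in a consistent model *)

Lemma quadratic_growth_ge0 (R : realType) (a b : R) :
  (forall n : nat, 0 <= n%:R ^+ 2 * a + n%:R * b) -> 0 <= a.
Proof.
move=> ab_ge0; rewrite leNgt; apply/negP => a_lt0.
have x_ge0 : 0 <= `|b| / - a by rewrite divr_ge0 // oppr_ge0 ltW.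
have := archi_boundP x_ge0; set n := Num.bound _.
rewrite ltr_pdivrMr ?oppr_gt0 // => bn.
have := ab_ge0 n; rewrite expr2 -mulrA -mulrDr => nab.
have n_gt0 : 0 < n%:R :> R.
  rewrite ltr0n lt0n; apply: contraTneq bn => ->.
  by rewrite mul0r -leNgt.
move: nab; rewrite pmulr_rge0 // leNgt => /negP; apply.
by have := ler_norm b; lra.
Qed.

Lemma edge_neq (G : sgraph) (u v : G) : edge u v -> u != v.
Proof. by apply: contraTneq => ->; rewrite edge_irrefl. Qed.

Section ConsistentModel.

Variables (R : realType) (P : sgraph -> Prop).
Hypothesis P_iso : graph_property P.
Hypothesis P_hereditary : hereditary P.
Variable M : ordering_model R P.
Hypothesis M_consistent : consistent M.

(** Consistency compares a graph with an induced subgraph; two copies of the same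
    configuration in different graphs are compared through the graph that they
    both induce on the index set. *)
Lemma prob_chain_transfer (T : finType) (H1 H2 : sgraph) (PH1 : P H1)
    (PH2 : P H2) (f : T -> H1) (g : T -> H2) :
  injective f -> injective g ->
  (forall i j, edge (f i) (f j) = edge (g i) (g j)) ->
  forall xs : seq T,
    prob_chain (M PH1) (map f xs) = prob_chain (M PH2) (map g xs).
Proof.
move=> fI gI fg xs.
pose e := [rel i j : T | edge (f i) (f j)].
have e_sym : symmetric e by move=> i j; apply: edge_sym.
have e_irrefl : irreflexive e by move=> i; apply: edge_irrefl.
pose TG := SGraph e_sym e_irrefl.
have fE : @induced_embedding TG H1 f by [].
have gE : @induced_embedding TG H2 g by split=> // i j; rewrite -fg.
have PT : P TG by apply: property_embedding fE PH1.
by rewrite -(M_consistent PT PH1 fE) -(M_consistent PT PH2 gE).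
Qed.

Lemma prob_last_transfer (H1 H2 : sgraph) (PH1 : P H1) (PH2 : P H2)
    (c1 u1 v1 : H1) (c2 u2 v2 : H2) :
  c1 != u1 -> c1 != v1 -> u1 != v1 -> c2 != u2 -> c2 != v2 -> u2 != v2 ->
  edge c1 u1 = edge c2 u2 -> edge c1 v1 = edge c2 v2 ->
  edge u1 v1 = edge u2 v2 ->
  prob_last (M PH1) c1 u1 v1 = prob_last (M PH2) c2 u2 v2.
Proof.
move=> cu1 cv1 uv1 cu2 cv2 uv2 ecu ecv euv.
pose f (T : Type) (c u v : T) (i : option bool) :=
  if i is Some b then if b then u else v else c.
have fI (T : eqType) (c u v : T) :
    c != u -> c != v -> u != v -> injective (f T c u v).
  move=> /eqP cu /eqP cv /eqP uv.
  by move=> [[]|] [[]|] //= e; exfalso; congruence.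
have fE i j : edge (f _ c1 u1 v1 i) (f _ c1 u1 v1 j)
            = edge (f _ c2 u2 v2 i) (f _ c2 u2 v2 j).
  case: i j => [[]|] [[]|] /=; rewrite ?edge_irrefl // 1?edge_sym;
    by rewrite ?(ecu, ecv, euv) 1?edge_sym.
have tr := prob_chain_transfer PH1 PH2 (fI _ _ _ _ cu1 cv1 uv1)
  (fI _ _ _ _ cu2 cv2 uv2) fE.
rewrite !prob_lastE //.
by rewrite (tr [:: Some true; Some false; None])
  (tr [:: Some false; Some true; None]).
Qed.

Lemma prob_last_half (H : sgraph) (PH : P H) (c u : H) : c != u ->
  prob_last (M PH) c u u = 1 / 2.
Proof.
move=> cu; rewrite prob_last_diag //; have := prob_pair_sum (M PH) cu.
pose f (b : bool) := if b then c else u; pose g (b : bool) := if b then u else c.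
have fI : injective f.
  by move=> [] [] // /eqP; rewrite /f ?(negPf cu) // eq_sym (negPf cu).
have gI : injective g.
  by move=> [] [] // /eqP; rewrite /g ?(negPf cu) // eq_sym (negPf cu).
have fg i j : edge (f i) (f j) = edge (g i) (g j).
  by case: i j => [] [] /=; rewrite ?edge_irrefl // edge_sym.
have := prob_chain_transfer PH PH fI gI fg [:: true; false].
by rewrite /= => ->; lra.
Qed.

(* A reference cherry [x y z] and a reference cocherry, with edge [a b] and
   isolated vertex [c], fix the values of [s] and [t] in the whole model. *)
Section Excess.

Variables (H1 H2 : sgraph) (PH1 : P H1) (PH2 : P H2).
Variables (x y z : H1) (a b c : H2).
Hypotheses (xz : x != z) (xyE : edge x y) (yzE : edge y z) (xzE : ~~ edge x z).
Hypotheses (ac : a != c) (bc : b != c).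
Hypotheses (abE : edge a b) (acE : ~~ edge a c) (bcE : ~~ edge b c).

Let s := prob_last (M PH1) y x z - 1 / 3.
Let t := prob_last (M PH2) c a b - 1 / 3.

Lemma prob_last_excess (H : sgraph) (PH : P H) (w u v : H) :
  w != u -> w != v -> u != v ->
  prob_last (M PH) w u v = 1 / 3 + excess s t (edge w u) (edge w v) (edge u v).
Proof.
have homog (w' u' v' : H) : w' != u' -> w' != v' -> u' != v' ->
    edge w' u' = edge w' v' -> edge w' u' = edge u' v' ->
    prob_last (M PH) w' u' v' = 1 / 3.
  move=> wu wv uv e1 e2.
  have := prob_last_sum (M PH) wu wv uv.
  have -> : prob_last (M PH) u' w' v' = prob_last (M PH) w' u' v'.
    apply: prob_last_transfer; rewrite 1?(eq_sym u' w') //.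
    - by rewrite edge_sym.
    - by rewrite -e2.
    - by rewrite -e1.
  have -> : prob_last (M PH) v' w' u' = prob_last (M PH) w' u' v'.
    apply: prob_last_transfer; rewrite 1?(eq_sym v') //.
    - by rewrite (edge_sym v').
    - by rewrite (edge_sym v') -e1.
  by lra.
have center (w' u' v' : H) : w' != u' -> w' != v' -> u' != v' ->
    edge w' u' -> edge w' v' -> ~~ edge u' v' ->
    prob_last (M PH) w' u' v' = 1 / 3 + s.
  move=> wu wv uv e1 e2 e3; rewrite /s addrC subrK.
  apply: prob_last_transfer => //; rewrite ?(edge_sym y x) ?e1 ?e2 ?xyE ?yzE //.
  - by rewrite eq_sym edge_neq.
  - by rewrite edge_neq.
  - by rewrite (negPf e3) (negPf xzE).
have cocenter (w' u' v' : H) : w' != u' -> w' != v' -> u' != v' ->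
    ~~ edge w' u' -> ~~ edge w' v' -> edge u' v' ->
    prob_last (M PH) w' u' v' = 1 / 3 + t.
  move=> wu wv uv e1 e2 e3; rewrite /t addrC subrK.
  apply: prob_last_transfer; rewrite // 1?eq_sym //.
  - by rewrite eq_sym edge_neq.
  - by rewrite (edge_sym c) (negPf e1) (negPf acE).
  - by rewrite (edge_sym c) (negPf e2) (negPf bcE).
  - by rewrite e3 abE.
have one_end (w' u' v' : H) : w' != u' -> w' != v' -> u' != v' ->
    edge w' u' -> ~~ edge w' v' ->
    prob_last (M PH) w' u' v' = 1 / 3 + (if edge u' v' then - s / 2 else - t / 2).
  move=> wu wv uv e1 e2; have := prob_last_sum (M PH) wu wv uv.
  case: ifPn => e3.
    rewrite (center u' w' v') 1?(eq_sym u' w') // 1?edge_sym //.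
    have -> : prob_last (M PH) v' w' u' = prob_last (M PH) w' u' v'.
      rewrite prob_lastC; apply: prob_last_transfer; rewrite 1?(eq_sym v') //.
      - by rewrite 1?eq_sym.
      - by rewrite (edge_sym v' u') e3 e1.
      - by rewrite edge_sym.
      - by rewrite (edge_sym u' w') e1 e3.
    by lra.
  rewrite (cocenter v' w' u') 1?(eq_sym v') // 1?(edge_sym v') //.
  have -> : prob_last (M PH) u' w' v' = prob_last (M PH) w' u' v'.
    apply: prob_last_transfer; rewrite 1?(eq_sym u' w') //.
    - by rewrite edge_sym.
    - by rewrite (negPf e2) (negPf e3).
    - by rewrite (negPf e2) (negPf e3).
  by lra.
move=> wu wv uv; rewrite /excess.
case wuE : (edge w u); case wvE : (edge w v); case uvE : (edge u v) => /=;
  rewrite ?addr0.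
- by apply: homog; rewrite ?wuE ?wvE ?uvE.
- by apply: center; rewrite ?wuE ?wvE ?uvE.
- by rewrite one_end ?uvE ?wuE ?wvE.
- by rewrite one_end ?uvE ?wuE ?wvE.
- by rewrite prob_lastC one_end 1?(edge_sym v) ?uvE ?wuE ?wvE // eq_sym.
- by rewrite prob_lastC one_end 1?(edge_sym v) ?uvE ?wuE ?wvE // eq_sym.
- by apply: cocenter; rewrite ?wuE ?wvE ?uvE.
- by apply: homog; rewrite ?wuE ?wvE ?uvE.
Qed.

End Excess.
End ConsistentModel.

(** * Second moments in blow-ups *)

Section SecondMoment.

Variables (R : realType) (P : sgraph -> Prop).
Hypothesis P_iso : graph_property P.
Hypothesis P_hereditary : hereditary P.
Variable M : ordering_model R P.
Hypothesis M_consistent : consistent M.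

Variables s t : R.
Hypothesis triples : forall (H : sgraph) (PH : P H) (w u v : H),
  w != u -> w != v -> u != v ->
  prob_last (M PH) w u v = 1 / 3 + excess s t (edge w u) (edge w v) (edge u v).

Variables (G : sgraph) (tau : {ffun G -> bool}).
Hypothesis P_blowup : forall I : finType, P (blowup I tau).

Let adj := clone_adjacency tau.

(** The clones [inr l] are the ones that are counted; the copies indexed by [K]
    are kept apart, so that the vertex [c] at which the count is evaluated is
    never one of them. *)
Definition clones_below (K : finType) (n : nat)
    (o : ordering (blowup (K + 'I_n)%type tau)) (c : G * K) (x : G) : R :=
  \sum_(l < n) (precedes o (x, inr l) (c.1, inl c.2))%:R.

(** The last term corrects the contribution of the coincidences of the two
    clones, when [x = y]: then the probability of both preceding [c] is 1/2
    instead of [1 / 3 + m]. *)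
Lemma clones_below_moment (K : finType) (n : nat) (c : G * K) (x y : G) :
  let m := excess s t (adj c.1 x) (adj c.1 y) (adj x y) in
  expect (M (P_blowup (K + 'I_n)%type))
    (fun o => clones_below o c x * clones_below o c y)
  = n%:R ^+ 2 * (1 / 3 + m) + n%:R * ((x == y)%:R * (1 / 6 - m)).
Proof.
move=> m; set mu := M _.
have -> : expect mu (fun o => clones_below o c x * clones_below o c y)
    = \sum_(l < n) \sum_(k < n)
        prob_last mu (c.1, inl c.2) (x, inr l) (y, inr k).
  rewrite /prob_last; under eq_bigr => l _ do rewrite -expect_sum.
  rewrite -expect_sum; apply: eq_expect => o.
  rewrite /clones_below mulr_suml; apply: eq_bigr => l _.
  rewrite mulr_sumr; apply: eq_bigr => k _.
  by rewrite -natrM mulnb.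
have cE (z : G) (l : 'I_n) :
    (((c.1, inl c.2) : blowup (K + 'I_n)%type tau) == (z, inr l)) = false.
  by apply/eqP => -[].
have last_value (l k : 'I_n) :
    prob_last mu (c.1, inl c.2) (x, inr l) (y, inr k)
    = 1 / 3 + m + (x == y)%:R * (1 / 6 - m) * (l == k)%:R.
  have [[xy lk]|xylk] := altP (@andP (x == y) (l == k)).
    rewrite -(eqP xy) -(eqP lk) !eqxx prob_last_half ?cE //.
    by rewrite /=; lra.
  have clone_neq : ((x, inr l) : blowup (K + 'I_n)%type tau) != (y, inr k).
    by apply: contra xylk => /eqP[-> ->]; rewrite !eqxx.
  rewrite triples ?cE //= /blowup_edge /= !cE clone_neq.
  have -> : (x == y)%:R * (1 / 6 - m) * (l == k)%:R = 0.
    by rewrite mulrAC -natrM mulnb (negPf xylk) mul0r.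
  by rewrite addr0.
under eq_bigr => l _ do under eq_bigr => k _ do rewrite last_value.
under eq_bigr => l _.
  rewrite big_split /= sumr_const card_ord -mulr_sumr (bigD1 l) //= eqxx.
  rewrite big1 ?addr0; last by move=> k /negPf kl; rewrite eq_sym kl.
  over.
by rewrite sumr_const card_ord mulr1 -[LHS]mulr_natl -[_ *+ n]mulr_natl; ring.
Qed.

(** The expected square of a weighted count of clones is nonnegative for every
    number [n] of clones, and the double sum is its coefficient of [n ^+ 2]. *)
Lemma blowup_excess_psd : excess_psd adj s t.
Proof.
move=> c L L0.
pose D (n : nat) (o : ordering (blowup (unit + 'I_n)%type tau)) :=
  \sum_(p <- L) p.2 * clones_below o (c, tt) p.1.
pose m (p q : G * R) := excess s t (adj c p.1) (adj c q.1) (adj p.1 q.1).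
apply: (@quadratic_growth_ge0 _ _
  (\sum_(p <- L) \sum_(q <- L) p.2 * q.2 * ((p.1 == q.1)%:R * (1 / 6 - m p q)))).
move=> n.
have : 0 <= expect (M (P_blowup (unit + 'I_n)%type)) (fun o => D n o * D n o).
  by apply: sumr_ge0 => o _; rewrite mulr_ge0 ?pmf_ge0 // -expr2 sqr_ge0.
have -> : expect (M (P_blowup (unit + 'I_n)%type)) (fun o => D n o * D n o)
  = \sum_(p <- L) \sum_(q <- L) p.2 * q.2 *
      (n%:R ^+ 2 * (1 / 3 + m p q) + n%:R * ((p.1 == q.1)%:R * (1 / 6 - m p q))).
  under eq_expect => o.
    rewrite /D mulr_suml; under eq_bigr => p _ do
      (rewrite mulr_sumr; under eq_bigr => q _ do rewrite mulrACA).
    over.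
  rewrite expect_sum; apply: eq_bigr => p _.
  rewrite expect_sum; apply: eq_bigr => q _.
  by rewrite expectZ (clones_below_moment n (c, tt)).
suff -> : \sum_(p <- L) \sum_(q <- L) p.2 * q.2 *
      (n%:R ^+ 2 * (1 / 3 + m p q) + n%:R * ((p.1 == q.1)%:R * (1 / 6 - m p q)))
  = n%:R ^+ 2 / 3 * ((\sum_(p <- L) p.2) * (\sum_(q <- L) q.2)) +
    (n%:R ^+ 2 * (\sum_(p <- L) \sum_(q <- L) p.2 * q.2 * m p q) +
     n%:R * (\sum_(p <- L) \sum_(q <- L)
               p.2 * q.2 * ((p.1 == q.1)%:R * (1 / 6 - m p q)))).
  by rewrite L0 mul0r mulr0 add0r.
rewrite mulr_suml !mulr_sumr -!big_split /=; apply: eq_bigr => p _.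
rewrite !mulr_sumr -!big_split /=; apply: eq_bigr => q _.
by field.
Qed.

End SecondMoment.

(** * Cherries and cocherries *)

Lemma cherry_exists (G : sgraph) : ~ disjoint_union_of_cliques G ->
  exists x y z : G, [/\ x != z, edge x y, edge y z & ~~ edge x z].
Proof.
move=> nG; apply: contrapT => no_cherry; apply: nG.
pose r := [rel x y : G | (x == y) || edge x y].
have r_equiv : {in [set: G] & &, equivalence_rel r}.
  move=> x y z _ _ _ /=; rewrite eqxx; split=> //.
  case: eqVneq => [-> //|xy] /= xyE.
  have trans (a b c : G) : edge a b -> edge b c -> (a == c) || edge a c.
    move=> ab bc; apply/negPn/negP; rewrite negb_or => /andP[ac nac].
    by apply: no_cherry; exists a, b, c.
  have yxE : edge y x by rewrite edge_sym.
  apply/idP/idP => /orP[/eqP<-|]; rewrite ?xyE ?yxE ?orbT //.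
    exact: trans yxE.
  exact: trans xyE.
have Dpart := equivalence_partitionP r_equiv.
exists (equivalence_partition r [set: G]) => // x y.
have /and3P[/eqP Dcover Dtriv _] := Dpart.
rewrite eq_pblock ?Dcover ?inE // pblock_equivalence_partition ?inE //=.
by case: eqVneq => [->|] //=; rewrite edge_irrefl.
Qed.

Lemma cocherry_exists (G : sgraph) : ~ complete_multipartite G ->
  exists a b c : G, [/\ a != c, b != c, edge a b, ~~ edge a c & ~~ edge b c].
Proof.
move=> nG; apply: contrapT => no_cocherry; apply: nG.
pose r := [rel x y : G | ~~ edge x y].
have r_equiv : {in [set: G] & &, equivalence_rel r}.
  move=> x y z _ _ _ /=; rewrite edge_irrefl; split=> // xy.
  have trans (a b c : G) : ~~ edge a c -> ~~ edge c b -> ~~ edge a b.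
    move=> ac cb; apply/negP => ab; apply: no_cocherry; exists a, b, c.
    rewrite (edge_sym b c); split=> //.
      by apply: contraNneq cb => <-.
    by apply: contraNneq ac => <-.
  apply/idP/idP => [xz|yz]; last exact: trans yz.
  by apply: trans xz; rewrite edge_sym.
have Dpart := equivalence_partitionP r_equiv.
exists (equivalence_partition r [set: G]) => // x y.
have /and3P[/eqP Dcover Dtriv _] := Dpart.
rewrite eq_pblock ?Dcover ?inE // pblock_equivalence_partition ?inE //=.
by rewrite negbK.
Qed.

(** * Exchangeable chains and the uniform model *)

Section OrderedSequences.

Variables (V : finType) (o : ordering V).

Definition order_seq (xs : seq V) : seq V := sort (relpre (fun x => rank o x : nat) leq) xs.

Lemma order_seq_sorted (xs : seq V) : uniq xs -> sorted (precedes o) (order_seq xs).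
Proof.
move=> xs_uniq; rewrite -(@eq_sorted _ (relpre (fun x => rank o x : nat) ltn)); last first.
  by move=> x y /=; rewrite rank_lt.
have : sorted ltn [seq (rank o x : nat) | x <- order_seq xs].
  rewrite ltn_sorted_uniq_leq; apply/andP; split.
    rewrite map_inj_uniq ?sort_uniq //.
    by move=> x y /val_inj; apply: rank_inj.
  by rewrite sorted_map; apply: sort_sorted => x y; apply: leq_total.
by rewrite sorted_map.
Qed.

Lemma sorted_precedes_uniq (xs : seq V) : sorted (precedes o) xs -> uniq xs.
Proof. exact: sorted_uniq (@precedes_trans V o) (@precedes_irrefl V o) xs. Qed.

Lemma sorted_precedes_eq (xs ys : seq V) :
  sorted (precedes o) xs -> sorted (precedes o) ys -> perm_eq xs ys -> xs = ys.
Proof.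
move=> xs_sorted ys_sorted /perm_mem.
exact: irr_sorted_eq (@precedes_trans V o) (@precedes_irrefl V o) _ _ _ _.
Qed.

End OrderedSequences.

Section ChainProbabilities.

Variables (R : realType) (V : finType) (mu : random_ordering R V).

Lemma prob_chain_eq0 (xs : seq V) : ~~ uniq xs -> prob_chain mu xs = 0.
Proof.
by move=> xs_nuniq; apply: big1 => o /sorted_precedes_uniq; rewrite (negPf xs_nuniq).
Qed.

(** Each ordering sorts exactly one permutation of [xs], so the equal
    probabilities of these permutations have sum 1. *)
Lemma prob_chain_exchangeable (xs : seq V) : uniq xs ->
  (forall ys, perm_eq ys xs -> prob_chain mu ys = prob_chain mu xs) ->
  prob_chain mu xs = (size xs)`!%:R^-1.
Proof.
move=> xs_uniq exch.
have : \sum_(ys <- permutations xs) prob_chain mu ys = 1.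
  under eq_bigr => ys _ do rewrite prob_chain_expect.
  rewrite -expect_sum -[RHS](expect_const mu 1); apply: eq_expect => o.
  rewrite (bigD1_seq (order_seq o xs)) ?permutations_uniq //=; last first.
    by rewrite mem_permutations perm_sort.
  rewrite order_seq_sorted // big_seq_cond big1 ?addr0 // => ys.
  rewrite mem_permutations => /andP[ys_perm /negP ys_neq].
  case: (boolP (sorted _ ys)) => // ys_sorted; case: ys_neq; apply/eqP.
  apply: (sorted_precedes_eq ys_sorted (order_seq_sorted o xs_uniq)).
  by rewrite (perm_trans ys_perm) // perm_sym perm_sort.
rewrite big_seq (eq_bigr (fun=> prob_chain mu xs)); last first.
  by move=> ys; rewrite mem_permutations => /exch.
rewrite -big_seq big_const_seq count_predT size_permutations //.
rewrite iter_addr_0 => e.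
have fact_neq0 : (size xs)`!%:R != 0 :> R by rewrite pnatr_eq0 -lt0n fact_gt0.
by apply: (mulfI fact_neq0); rewrite mulr_natl e mulfV.
Qed.

Lemma pmf_prob_chain (o : ordering V) : mu o = prob_chain mu (order_seq o (enum V)).
Proof.
rewrite /prob_chain (big_pred1 o) // => o' /=; apply/idP/eqP => [sorted'|->].
  apply: val_inj; apply/setP => -[x y].
  have sorted_o := order_seq_sorted o (enum_uniq V).
  have memP z : z \in order_seq o (enum V) by rewrite mem_sort mem_enum.
  have half (o1 o2 : ordering V) : sorted (precedes o1) (order_seq o (enum V)) ->
      sorted (precedes o2) (order_seq o (enum V)) ->
      precedes o1 x y -> precedes o2 x y.
    move=> s1 s2 xy; apply: (sorted_ltn_index (@precedes_trans V o2) s2) => //.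
    rewrite ltnNge leq_eqVlt; apply/negP => /orP[/eqP e|lt].
      have yx : y = x by rewrite -[y](nth_index x (memP y)) e nth_index.
      by rewrite yx precedes_irrefl in xy.
    have := sorted_ltn_index (@precedes_trans V o1) s1 y x (memP y) (memP x) lt.
    by move/(precedes_trans xy); rewrite precedes_irrefl.
  by apply/idP/idP; apply: half.
exact: order_seq_sorted (enum_uniq V).
Qed.

End ChainProbabilities.

Section UniformModel.

Variable V : finType.

Definition relabel_set (f : V -> V) (o : ordering V) : {set V * V} :=
  [set p | precedes o (f p.1) (f p.2)].

Lemma relabel_setP (f : V -> V) (o : ordering V) :
  injective f -> strict_total_order (relabel_set f o).
Proof.
move=> fI; apply/and3P; split.
- by apply/forallP => x; rewrite inE precedes_irrefl.
- apply/forallP => x; apply/forallP => y; apply/forallP => z.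
  by apply/implyP; rewrite !inE /= => /andP[]; apply: precedes_trans.
- apply/forallP => x; apply/forallP => y; apply/implyP => xy.
  by rewrite !inE /=; apply: precedes_total; rewrite (inj_eq fI).
Qed.

Definition relabel (f : V -> V) (fI : injective f) (o : ordering V) :
  ordering V := Ordering (relabel_setP o fI).

Lemma relabel_precedes (f : V -> V) (fI : injective f) (o : ordering V) :
  precedes (relabel fI o) =2 relpre f (precedes o).
Proof. by move=> x y; rewrite /precedes inE. Qed.

Lemma relabel_inj (f : V -> V) (fI : injective f) : injective (relabel fI).
Proof.
move=> o1 o2 e; apply: val_inj; apply/setP => -[x y].
have [g _ gK] := injF_bij fI.
have := relabel_precedes fI o2 (g x) (g y).
by rewrite -e relabel_precedes /= !gK.
Qed.

Lemma perm_eq_map_inj (xs ys : seq V) : uniq xs -> perm_eq ys xs ->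
  exists2 f : V -> V, injective f & map f xs = ys.
Proof.
move=> xs_uniq ys_xs; have ys_uniq : uniq ys by rewrite (perm_uniq ys_xs).
have size_ys := perm_size ys_xs.
pose f x := if x \in xs then nth x ys (index x xs) else x.
have f_mem x : (f x \in xs) = (x \in xs).
  rewrite /f; case: ifP => xxs; last by rewrite xxs.
  by rewrite -(perm_mem ys_xs) mem_nth // size_ys index_mem.
exists f.
  move=> x y e; have := f_mem x; rewrite e f_mem => yx.
  move: e; rewrite /f yx; case: ifP => // xxs.
  have -> : nth x ys (index x xs) = nth y ys (index x xs).
    by apply: set_nth_default; rewrite size_ys index_mem.
  move/eqP.
  rewrite nth_uniq ?size_ys ?index_mem ?yx // => /eqP.
  by apply: (index_inj x); rewrite ?yx.
have [xs0|[x0 _]] : xs = [::] \/ exists x0, x0 \in xs.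
  by case: (xs) => [|x l]; [left | right; exists x; rewrite mem_head].
  by move: size_ys; rewrite xs0 => /size0nil->.
apply: (@eq_from_nth _ x0); rewrite size_map // => i ltin.
rewrite (nth_map x0) // /f mem_nth // index_uniq //.
by apply: set_nth_default; rewrite size_ys.
Qed.

(** Relabelling the vertices by a permutation is a bijection on the orderings, so
    the uniform distribution gives the same probability to all permutations of
    [xs]. *)
Lemma uniform_prob_chain (R : realType) (xs : seq V) :
  prob_chain (uniform_ordering R V) xs =
  if uniq xs then (size xs)`!%:R^-1 else 0.
Proof.
case: ifP => [xs_uniq|/negbT]; last exact: prob_chain_eq0.
apply: prob_chain_exchangeable => // ys /(perm_eq_map_inj xs_uniq)[f fI <-].
rewrite /prob_chain [RHS](reindex_inj (relabel_inj (fI := fI))).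
apply: eq_bigl => o; rewrite sorted_map.
by apply: eq_sorted => x y; rewrite relabel_precedes.
Qed.

End UniformModel.

Lemma uniform_model_consistent (R : realType) (P : sgraph -> Prop) :
  consistent (@uniform_model R P).
Proof.
move=> H G PH PG phi [phiI _] xs.
by rewrite !uniform_prob_chain map_inj_uniq // size_map.
Qed.

(** * Replacing a vertex of a chain by a vertex of another class *)

Section Insertion.

Variables (R : realType) (V : finType) (o : ordering V).

Definition precedes_opt (dflt : R) (y : option V) (u : V) : R :=
  if y is Some y then (precedes o u y)%:R else dflt.

(** In a sorted chain, [u] lies between two consecutive entries if it precedes the
    second but not the first.  Writing this as a difference reduces the number of
    clones that fit in a gap to numbers of clones below a vertex.  The default
    values 1 and 0 stand for a missing upper and a missing lower entry. *)
Lemma sorted_insert (pre post : seq V) (u : V) : u \notin pre ->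
  (sorted (precedes o) (pre ++ u :: post))%:R =
  (sorted (precedes o) (pre ++ post))%:R *
  (precedes_opt 1 (ohead post) u - precedes_opt 0 (ohead (rev pre)) u) :> R.
Proof.
case/lastP: pre => [_|pre x].
  by case: post => [|y post] /=; rewrite ?subr0 ?mulr1 // -natrM mulnb andbC.
rewrite mem_rcons inE negb_or => /andP[ux _].
rewrite rev_rcons /= !cat_rcons !sorted_cat_cons /=.
rewrite (precedes_asym o ux).
case: (sorted _ (rcons pre x)); last by rewrite !mul0r.
case: post => [|y post] /=.
  by case: (precedes o u x) => /=; ring.
case: (path _ y post); rewrite ?andbF ?mul0r // !andbT.
case xy: (precedes o x y).
  case xu: (precedes o u x) => /=; last by ring.
  by rewrite (precedes_trans xu xy) /=; ring.
case xu: (precedes o u x) => /=; first by ring.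
case uy: (precedes o u y) => /=; last by ring.
have {}xu : precedes o x u by rewrite (precedes_asym o ux) xu.
by rewrite (precedes_trans xu uy) in xy.
Qed.

End Insertion.

Section Replacement.

Variables (R : realType) (P : sgraph -> Prop).
Hypothesis P_iso : graph_property P.
Hypothesis P_hereditary : hereditary P.
Variable M : ordering_model R P.
Hypothesis M_consistent : consistent M.
Hypothesis triples_uniform : forall (H : sgraph) (PH : P H) (w u v : H),
  w != u -> w != v -> u != v -> prob_last (M PH) w u v = 1 / 3.
Variables (G : sgraph) (tau : {ffun G -> bool}).
Hypothesis P_blowup : forall I : finType, P (blowup I tau).

(** When all triples are uniform, the terms of order [n ^+ 2] cancel. *)
Lemma clones_below_close (K : finType) (n : nat) (c : G * K) (x y : G) :
  expect (M (P_blowup (K + 'I_n)%type))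
    (fun o => (clones_below R o c x - clones_below R o c y) ^+ 2)
  <= n%:R / 3.
Proof.
have triples (H : sgraph) (PH : P H) (w u v : H) :
    w != u -> w != v -> u != v ->
    prob_last (M PH) w u v =
    1 / 3 + excess 0 0 (edge w u) (edge w v) (edge u v).
  move=> wu wv uv; rewrite triples_uniform //.
  by case: (edge w u); case: (edge w v); case: (edge u v); rewrite /excess /=; lra.
have excess0 a b d : excess (0 : R) 0 a b d = 0.
  by case: a; case: b; case: d; rewrite /excess /=; lra.
have moment := clones_below_moment P_iso P_hereditary M_consistent triples P_blowup n c.
under eq_expect => o.
  rewrite (_ : _ ^+ 2 = clones_below R o c x * clones_below R o c x +
     (- 2 * (clones_below R o c x * clones_below R o c y) +
      clones_below R o c y * clones_below R o c y)); last by ring.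
  over.
rewrite !expectD expectZ !moment !excess0 !eqxx.
have : 0 <= n%:R :> R by [].
by case: (x == y) => /=; lra.
Qed.

(** Replace [u] and [v] by a random one among [N] further clones of their classes.
    For a given ordering of the rest of the chain, the two probabilities differ by
    the difference of the numbers of clones in the gap to be filled, divided by
    [N].  By [clones_below_close] that difference is of order [N ^ (1/2)]. *)
Lemma prob_chain_replace_le (K : finType) (pre post : seq (blowup K tau))
    (u v : blowup K tau) :
  u \notin pre ++ post -> v \notin pre ++ post ->
  prob_chain (M (P_blowup K)) (pre ++ u :: post) <=
  prob_chain (M (P_blowup K)) (pre ++ v :: post).
Proof.
move=> u_new v_new; rewrite -subr_ge0.
apply: (@quadratic_growth_ge0 _ _ (4 / 3)) => n.
(* With [N = n ^ 2], the bound [2 n (X - Y) <= X ^+ 2 + Y ^+ 2 + 2 n ^+ 2] turns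
   second moments of order [N] into a bound of order [N] for [n] times the
   expected difference; after division by [n ^+ 2], it bounds [n] times the
   difference of the two probabilities by a constant. *)
pose N := (n ^ 2)%N; pose J := (K + 'I_N)%type.
pose mu := M (P_blowup J).
pose emb (p : blowup K tau) : blowup J tau := (p.1, inl p.2).
pose clone (w : blowup K tau) (l : 'I_N) : blowup J tau := (w.1, inr l).
have embI : injective emb by move=> [p i] [q j] [-> ->].
have clone_chain (w : blowup K tau) (l : 'I_N) : w \notin pre ++ post ->
    prob_chain (M (P_blowup K)) (pre ++ w :: post) =
    prob_chain mu (map emb pre ++ clone w l :: map emb post).
  rewrite mem_cat negb_or => /andP[w_pre w_post].
  pose g p := if p == w then clone w l else emb p.
  have gI : injective g.
    by move=> p q; rewrite /g; case: eqP => [->|_]; case: eqP => [->|_] // /embI.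
  have gE : induced_embedding g.
    have g1 p : (g p).1 = p.1 by rewrite /g; case: eqP => [->|].
    by split=> // p q; rewrite /= /blowup_edge (inj_eq gI) !g1.
  rewrite (M_consistent (P_blowup K) (P_blowup J) gE) map_cat /= {2}/g eqxx.
  have gemb s : w \notin s -> map g s = map emb s.
    move=> ws; apply/eq_in_map => p ps; rewrite /g.
    by case: eqP ps => // ->; rewrite (negPf ws).
  by rewrite !gemb.
pose below o c x := clones_below R (o : ordering (blowup J tau)) c x.
pose gap o (y : option (blowup K tau)) :=
  if y is Some c then below o c u.1 - below o c v.1 else 0.
pose S o : R := (sorted (precedes o) (map emb pre ++ map emb post))%:R.
have gap_sum o d y :
    \sum_(l < N) (precedes_opt o d (omap emb y) (clone u l) -
                  precedes_opt o d (omap emb y) (clone v l)) = gap o y.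
  case: y => [c|] /=; first by rewrite sumrB.
  by rewrite big1 // => l _; rewrite subrr.
have diffE : N%:R * (prob_chain (M (P_blowup K)) (pre ++ u :: post) -
                     prob_chain (M (P_blowup K)) (pre ++ v :: post)) =
    expect mu (fun o => S o * (gap o (ohead post) - gap o (ohead (rev pre)))).
  have -> : expect mu (fun o => S o * (gap o (ohead post) - gap o (ohead (rev pre))))
    = \sum_(l < N) (prob_chain mu (map emb pre ++ clone u l :: map emb post)
                  - prob_chain mu (map emb pre ++ clone v l :: map emb post)).
    under eq_bigr => l _ do
      rewrite !prob_chain_expect -[X in _ - X]mul1r -mulNr -expectZ -expectD.
    rewrite -expect_sum; apply: eq_expect => o.
    rewrite -(gap_sum o 1) -(gap_sum o 0) -sumrB mulr_sumr.
    apply: eq_bigr => l _.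
    have new w : clone w l \notin map emb pre by apply/mapP => -[].
    have headE s : ohead (map emb s) = omap emb (ohead s) by case: s.
    rewrite !sorted_insert // -map_rev !headE /S; ring.
  under eq_bigr => l _ do rewrite -!clone_chain //.
  by rewrite sumr_const card_ord mulr_natl.
have gap_moment y : expect mu (fun o => gap o y ^+ 2) <= N%:R / 3.
  case: y => [c|] /=; first exact: clones_below_close.
  by rewrite expr0n /= expect_const divr_ge0.
have : 2 * n%:R * expect mu (fun o => S o * (gap o (ohead post) - gap o (ohead (rev pre))))
   <= N%:R / 3 + N%:R / 3 + 2 * N%:R.
  rewrite -expectZ; apply: le_trans (_ : expect mu (fun o =>
     gap o (ohead post) ^+ 2 + gap o (ohead (rev pre)) ^+ 2 + 2 * N%:R) <= _).
    apply: expect_le => o; rewrite natrX /S.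
    have sq1 := sqr_ge0 (gap o (ohead post) - n%:R).
    have sq2 := sqr_ge0 (gap o (ohead (rev pre)) + n%:R).
    have sq3 := sqr_ge0 (gap o (ohead post)).
    have sq4 := sqr_ge0 (gap o (ohead (rev pre))).
    have sq5 := sqr_ge0 (n%:R : R).
    by case: (sorted _ _) => /=; nra.
  rewrite !expectD expect_const.
  by apply: lerD => //; apply: lerD.
rewrite -diffE natrX.
have [->|n_gt0] := posnP n; first by rewrite !mul0r expr0n /= !mul0r addr0.
have {}n_gt0 : 0 < n%:R :> R by rewrite ltr0n.
set d := _ - _; rewrite -[_ (pre ++ v :: post) - _]opprB -/d => le.
rewrite -(pmulr_rge0 _ n_gt0).
by nra.
Qed.

Lemma prob_chain_replace (K : finType) (pre post : seq (blowup K tau))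
    (u v : blowup K tau) :
  u \notin pre ++ post -> v \notin pre ++ post ->
  prob_chain (M (P_blowup K)) (pre ++ u :: post) =
  prob_chain (M (P_blowup K)) (pre ++ v :: post).
Proof. by move=> uN vN; apply: le_anti; rewrite !prob_chain_replace_le. Qed.

(** The two sequences are placed in disjoint layers of a blow-up, so that the
    vertices of one can be replaced by those of the other one at a time without
    ever repeating a vertex, even if the sequences overlap. *)
Lemma prob_chain_all_equal (PG : P G) (xs ys : seq G) :
  uniq xs -> uniq ys -> size xs = size ys ->
  prob_chain (M PG) xs = prob_chain (M PG) ys.
Proof.
move=> xs_uniq ys_uniq size_xy.
pose layer (b : bool) (x : G) : blowup bool tau := (x, b).
have layerI b : injective (layer b) by move=> x y [].
have layerE b : induced_embedding (layer b).
  split=> // x y; rewrite /= /blowup_edge (inj_eq (layerI b)) /clone_adjacency /=.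
  by case: eqP => [->|] //=; rewrite edge_irrefl.
rewrite (M_consistent PG (P_blowup bool) (layerE false)).
rewrite (M_consistent PG (P_blowup bool) (layerE true)).
have layerN b xs' x : (x, b) \notin map (layer (~~ b)) xs'.
  by apply/mapP => -[z _ [_]]; case: b.
suff gen pre : uniq (map (layer true) (pre ++ ys)) ->
    prob_chain (M (P_blowup bool)) (map (layer true) pre ++ map (layer false) xs) =
    prob_chain (M (P_blowup bool)) (map (layer true) pre ++ map (layer true) ys).
  by apply: (gen [::]); rewrite map_inj_uniq.
elim: xs ys xs_uniq size_xy {ys_uniq} pre => [|x xs IH] [|y ys] //=.
move=> /andP[x_xs xs_uniq] [size_xy] pre pre_uniq.
rewrite (@prob_chain_replace _ _ _ _ (layer true y)).
- have := IH ys xs_uniq size_xy (rcons pre y).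
  rewrite cat_rcons => /(_ pre_uniq).
  by rewrite map_rcons !cat_rcons.
- rewrite mem_cat negb_or (layerN false) /=.
  by rewrite mem_map.
- rewrite mem_cat negb_or (layerN true) andbT.
  move: pre_uniq; rewrite map_cat cat_uniq => /and3P[_ + _].
  by rewrite /= negb_or => /andP[].
Qed.

End Replacement.

(** * Uniqueness of the consistent model *)

Theorem theorem1p3 (R : realType) (P : sgraph -> Prop)
    (P_iso : graph_property P)
    (P_hereditary : hereditary P)
    (P_twins : forall G : sgraph, P G -> forall v : G,
       exists adj : bool, P (replace_by_twins v adj))
    (P_nontrivial : exists G : sgraph,
       P G /\ ~ disjoint_union_of_cliques G /\ ~ complete_multipartite G) :
  uniform_property R P.
Proof.
split; first exact: uniform_model_consistent.
move=> M M_consistent G PG o.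
have triples_uniform (H : sgraph) (PH : P H) (w u v : H) :
    w != u -> w != v -> u != v -> prob_last (M H PH) w u v = 1 / 3.
  have [G0 [PG0 [/cherry_exists cherry /cocherry_exists cocherry]]] := P_nontrivial.
  have [x [y [z [xz xyE yzE xzE]]]] := cherry.
  have [a [b [c [ac bc abE acE bcE]]]] := cocherry.
  have triples := prob_last_excess P_iso P_hereditary M_consistent PG0 PG0
    xz xyE yzE xzE ac bc abE acE bcE.
  set s := _ - _ in triples; set t := _ - _ in triples.
  have [tau P_blowup] := blowup_exists P_iso P_hereditary P_twins PG0.
  have psd := blowup_excess_psd P_iso P_hereditary M_consistent triples P_blowup.
  have adjE (i j : G0) : i != j -> clone_adjacency tau i j = edge i j.
    by rewrite /clone_adjacency => /negPf->.
  have adj_sym := clone_adjacency_sym tau.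
  have xy := edge_neq xyE; have yz := edge_neq yzE; have ab := edge_neq abE.
  rewrite -adjE // in xyE; rewrite -adjE // in yzE; rewrite -adjE // in xzE.
  rewrite -adjE // in abE; rewrite -adjE // in acE; rewrite -adjE // in bcE.
  have s0 : s = 0 := cherry_excess_eq0 adj_sym psd xyE yzE xzE abE acE bcE.
  (* In the complement, [a c b] is a cherry with excess [t], and [x z] with [y]
     form a cocherry. *)
  have t0 : t = 0.
    apply: (@cherry_excess_eq0 _ _ _ t s a c b x z y _ (excess_psd_compl psd));
      rewrite ?negbK //.
    - by move=> i j; rewrite adj_sym.
    - by rewrite adj_sym.
    - by rewrite adj_sym.
  move=> wu wv uv; rewrite triples // s0 t0.
  by case: (edge w u); case: (edge w v); case: (edge u v); rewrite /excess /=; lra.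
have [tau P_blowup] := blowup_exists P_iso P_hereditary P_twins PG.
have enum_o_uniq : uniq (order_seq o (enum G)) by rewrite sort_uniq enum_uniq.
rewrite pmf_prob_chain prob_chain_exchangeable //.
  by rewrite size_sort -cardE.
move=> ys ys_perm; apply: (prob_chain_all_equal P_iso P_hereditary M_consistent triples_uniform P_blowup).
- by rewrite (perm_uniq ys_perm).
- by [].
- exact: perm_size.
Qed.
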